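(* Let $G$ be a finite connected bipartite biregular graph whose first part has $n$ vertices, each of degree $a$, and whose second part has $m$ vertices, each of degree $b=an/m$. Let $v$ be a vertex of the second part. For an integer $k$, let $\tau^v_{>k}(G)$ be the number of spanning trees of $G$ in which $v$ has degree strictly greater than $k$, and $\tau^v_{\le k}(G)$ the number of spanning trees of $G$ in which $v$ has degree at most $k$. Suppose $k=\theta\cdot b/a$ is a non-negative integer with $k<b$ (where $\theta$ is real). Then: (i) if $\theta\ge 1$, then $\displaystyle \tau^v_{>k}(G)\le\left(\theta^{-1}\exp\!\left(\frac{\theta-1}{\theta}\right)\right)^k\frac{a^n b^m}{mn}$; (ii) if $\theta\le 1$, then $\displaystyle \tau^v_{\le k+1}(G)\le\left(\theta^{-1}\exp\!\left(\frac{\theta-1}{\theta}\right)\right)^k\frac{a^n b^m}{(m-1)n}$.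
   Context: A bipartite graph is biregular if all vertices within each part have the same degree. The degree of $v$ in a spanning tree $t$ is the number of edges of $t$ incident to $v$. *)

(* Defs.v *)
From mathcomp Require Import all_boot all_order all_algebra.
From mathcomp Require Import boolp.

Set Implicit Arguments.
Unset Strict Implicit.
Unset Printing Implicit Defensive.

(* A finite simple graph is a symmetric irreflexive [e : rel T] on a finType [T];
   its edges are the two-element sets [[set x; y]] with [e x y]. *)

Section Graphs.
Variable T : finType.
Implicit Types (e : rel T) (A B : {set T}) (t : {set {set T}}) (v : T).

Definition edges e : {set {set T}} := [set [set x; y] | x in T, y in T & e x y].

Definition degree e v : nat := #|[set w | e v w]|.

Definition connected_graph e : Prop := forall x y, connect e x y.

(* A closed walk x, y, x along one edge is a [ucycle] of size 2; genuine graph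
   cycles are the duplicate-free ones of size at least 3. *)
Definition acyclic_graph e : Prop :=
  forall c : seq T, ucycle e c -> (size c <= 2)%N.

Definition bipartition e A B : Prop :=
  [/\ A :|: B = [set: T], [disjoint A & B]
    & forall x y, e x y -> (x \in A) = (y \in B)].

Definition biregular e A B (a b : nat) : Prop :=
  {in A, forall x, degree e x = a} /\ {in B, forall y, degree e y = b}.

(* Adjacency in the spanning subgraph (all of [T]) with edge set [t]. *)
Definition adj t : rel T := [rel x y | [set x; y] \in t].

Definition spanning_tree e t : Prop :=
  [/\ t \subset edges e, connected_graph (adj t) & acyclic_graph (adj t)].

Definition tree_degree t v : nat := #|[set f in t | v \in f]|.

Definition tau_gt e v (k : nat) : nat :=
  #|[set t : {set {set T}} | `[< spanning_tree e t >] & (k < tree_degree t v)%N]|.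

Definition tau_le e v (k : nat) : nat :=
  #|[set t : {set {set T}} | `[< spanning_tree e t >] & (tree_degree t v <= k)%N]|.

End Graphs.

(* Main.v *)
Require Import Defs.
From mathcomp Require Import all_boot all_order all_fingroup all_algebra.
From mathcomp Require Import boolp reals sequences exp.
From mathcomp Require Import ring lra.

(** Give weight x to the edges at v and 1 to the others, and let P(x) be the
    sum of x ^ deg_t(v) over the spanning trees t.  Orienting trees towards v
    and expanding the determinant of the reduced weighted Laplacian by rows
    bounds P(x) by that determinant.  Let r_i, d_j be the weighted degrees in
    the two parts, M the weighted biadjacency matrix and W the total weight.
    Eliminating the first part, adding the rank-one matrix d d^T / W and using
    Hadamard's inequality together with 1 + z <= exp z gives
    [P(x) <= (prod r) (prod d) / W * exp (1 - s)], where
    [s = sum_(i, j) M_ij ^ 2 / (r_i d_j)].  Here s = n / b whatever x is, because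
    M_ij ^ 2 / d_j = M_ij / b, and exp (1 - s) <= 1 / s.  The theorem follows by
    comparing x ^ (k + 1) with x ^ deg_t(v) at x = theta. *)

Set Implicit Arguments.
Unset Strict Implicit.
Unset Printing Implicit Defensive.
Import Order.TTheory GRing.Theory Num.Theory.
Local Open Scope ring_scope.

(** * Schur complements, positive semidefinite matrices and Hadamard's inequality *)

Lemma det_schur (F : fieldType) n1 n2 (Aul : 'M[F]_n1) (Aur : 'M_(n1, n2))
    (Adl : 'M_(n2, n1)) (Adr : 'M_n2) :
  Aul \in unitmx ->
  \det (block_mx Aul Aur Adl Adr) =
  \det Aul * \det (Adr - Adl *m invmx Aul *m Aur).
Proof.
move=> Au; set S := Adr - _.
have -> : block_mx Aul Aur Adl Adr =
    block_mx 1%:M 0 (Adl *m invmx Aul) 1%:M *m block_mx Aul Aur 0 S.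
  rewrite mulmx_block !(mul1mx, mul0mx, mulmx0, addr0) mulmxKV //.
  by rewrite /S addrC subrK.
by rewrite det_mulmx det_lblock !det1 !mul1r det_ublock.
Qed.

Section Hadamard.
Variable R : realFieldType.

Definition psd n (A : 'M[R]_n) :=
  A^T = A /\ forall x : 'cV_n, 0 <= (x^T *m A *m x) 0 0.

Lemma psd_congr n p (A : 'M[R]_n) (P : 'M[R]_(n, p)) :
  psd A -> psd (P^T *m A *m P).
Proof.
move=> [symA posA]; split=> [|x].
  by rewrite !trmx_mul trmxK symA !mulmxA.
by have := posA (P *m x); rewrite trmx_mul !mulmxA.
Qed.

Lemma psd_block n1 n2 (A : 'M[R]_n1) (B : 'M[R]_n2) :
  psd A -> psd B -> psd (block_mx A 0 0 B).
Proof.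
move=> [symA posA] [symB posB]; split=> [|x].
  by rewrite tr_block_mx symA symB !trmx0.
rewrite -(vsubmxK x) tr_col_mx mul_row_block !mulmx0 addr0 add0r.
by rewrite mul_row_col mxE addr_ge0.
Qed.

(** The Schur complement is the congruence of the block matrix by the column of blocks
    [- (invmx Aul *m Aur)] and 1, so [psd_congr] applies. *)
Lemma psd_schur n1 n2 (Aul : 'M[R]_n1) (Aur : 'M_(n1, n2))
    (Adl : 'M_(n2, n1)) (Adr : 'M_n2) :
  Aul \in unitmx -> psd (block_mx Aul Aur Adl Adr) ->
  psd (Adr - Adl *m invmx Aul *m Aur).
Proof.
move=> Au psdA.
have [symA _] := psdA.
move: symA; rewrite tr_block_mx => /eq_block_mx[symul tl tr symr].
have := psd_congr (col_mx (- (invmx Aul *m Aur)) 1%:M) psdA.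
rewrite tr_col_mx trmx1 mul_row_block !mul1mx.
rewrite linearN /= trmx_mul trmx_inv symul tr !mulNmx mulmxKV //.
by rewrite addNr mul_row_col mul0mx add0r mulmx1 addrC.
Qed.

Lemma psd_diag n (A : 'M[R]_n) i : psd A -> 0 <= A i i.
Proof.
case=> _ /(_ (delta_mx i 0)).
by rewrite trmx_delta -rowE -colE !mxE.
Qed.

Lemma psd_diag0 n (A : 'M[R]_n) i j : psd A -> A i i = 0 -> A i j = 0.
Proof.
move=> [symA posA] A0; apply/eqP; apply: contraT => nz.
(* With A i i = 0 the form at t e_i + e_j equals 2 t A i j + A j j, which is affine in t; this t
   gives it the value -1. *)
have := posA ((- (A j j + 1) / (A i j *+ 2)) *: delta_mx i 0 + delta_mx j 0).
have symij : A j i = A i j by rewrite -[in RHS]symA mxE.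
set t := _ / _.
have -> : (t *: delta_mx i 0 + delta_mx j 0)^T =
    t *: delta_mx 0 i + delta_mx 0 j :> 'rV[R]_n.
  by rewrite linearD linearZ /= !trmx_delta.
rewrite !(mulmxDl, mulmxDr) -!scalemxAl.
rewrite -!scalemxAr -!rowE -!colE !mxE A0 symij.
have -> : t * (t * 0) + t * A i j + (t * A i j + A j j) = -1.
  by rewrite /t; field.
by rewrite lerNr oppr0 ler10.
Qed.

(** Induction through the Schur complement of the corner entry: it is again positive semidefinite,
    and its diagonal entries are those of [A] minus squares divided by [A 0 0]. If the corner
    vanishes, so does the first row, and the determinant is 0. *)
Lemma hadamard n (A : 'M[R]_n) : psd A -> 0 <= \det A <= \prod_i A i i.
Proof.
elim: n A => [|n IHn] A psdA; first by rewrite det_mx00 big_ord0 ler01 lexx.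
have [A0|nzA] := eqVneq (A 0 0) 0.
  rewrite (expand_det_row _ 0) big1 ?lexx ?prodr_ge0 // => [i _|j _].
    exact: psd_diag.
  by rewrite (psd_diag0 _ psdA) ?mul0r.
have posA : 0 < A 0 0 by rewrite lt_neqAle eq_sym nzA psd_diag.
pose A' : 'M_(1 + n) := A.
have e00 : ulsubmx A' = (A 0 0)%:M.
  by apply/matrixP=> i j; rewrite !ord1 !mxE /=; congr (A _ _); apply/val_inj.
have Au : ulsubmx A' \in unitmx by rewrite e00 unitmxE det_scalar1 unitfE.
move: (psdA); rewrite -[X in psd X](submxK A') => psdA'.
have symij i j : A i j = A j i by case: psdA => /matrixP/(_ j i); rewrite mxE.
have psdS := psd_schur Au psdA'.
have [d0 d1] := andP (IHn _ psdS).
have detA := det_schur (ursubmx A') (dlsubmx A') (drsubmx A') Au.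
rewrite submxK [in X in X * _]e00 det_scalar1 in detA.
rewrite [\det A]detA pmulr_rge0 // d0 big_ord_recl ler_pM2l //=.
apply: (le_trans d1); apply: ler_prod => i _; rewrite psd_diag //=.
rewrite e00 invmx_scalar mul_mx_scalar -scalemxAl.
have -> : dlsubmx A' = (ursubmx A')^T.
  apply/matrixP=> k l; rewrite !mxE.
  exact: symij.
rewrite !mxE (_ : A' (rshift 1 i) _ = A (lift ord0 i) (lift ord0 i)).
  rewrite gerBl mulr_ge0 ?invr_ge0 ?(ltW posA) // sumr_ge0 // => j _.
  by rewrite mxE -expr2 sqr_ge0.
by congr (A _ _); apply: val_inj.
Qed.

End Hadamard.

(** * Determinant bound for the reduced Laplacian of a weighted bipartite graph *)

Section BipartiteLaplacian.
Variables (R : realType) (n m : nat) (M : 'M[R]_(n, m)) (c : 'I_n -> R).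
Hypotheses (M_ge0 : forall i j, 0 <= M i j) (c_ge0 : forall i, 0 <= c i).

Let r i := c i + \sum_j M i j.
Let d j := \sum_i M i j.
Let d0 := \sum_i c i.
Let W := d0 + \sum_j d j.

Hypotheses (r_gt0 : forall i, 0 < r i) (d_gt0 : forall j, 0 < d j).
Hypothesis d0_gt0 : 0 < d0.

(* The root lies in the second part and is left out; [c i] is the weight of the
   edge from [i] to it. *)
Definition bip_laplacian : 'M[R]_(n + m) :=
  block_mx (diag_mx (\row_i (c i + \sum_j M i j))) (- M)
           (- M^T) (diag_mx (\row_j \sum_i M i j)).

Let S : 'M[R]_m :=
  diag_mx (\row_j d j) - (- M^T) *m invmx (diag_mx (\row_i r i)) *m (- M).

Let W_gt0 : 0 < W.
Proof. by rewrite ltr_wpDr // sumr_ge0 // => j _; apply: ltW. Qed.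

Let sum_r : \sum_i r i = W.
Proof. by rewrite big_split /= exchange_big. Qed.

Let unit_r : diag_mx (\row_i r i) \in unitmx.
Proof.
rewrite unitmxE det_diag unitfE; apply/prodf_neq0 => i _.
by rewrite mxE gt_eqF.
Qed.

Let SE j k : S j k = (j == k)%:R * d j - \sum_i M i j * M i k / r i.
Proof.
rewrite /S; have -> : invmx (diag_mx (\row_i r i)) = diag_mx (\row_i (r i)^-1).
  apply: (can_inj (mulKmx unit_r)); rewrite mulmxV // mulmx_diag.
  apply/matrixP=> i l; rewrite !mxE; case: eqP => // ->.
  by rewrite divff // gt_eqF.
rewrite mul_mx_diag !mxE eq_sym mulr_natl; congr (_ *+ _ - _).
by apply: eq_bigr => i _; rewrite !mxE mulNr mulrNN mulrAC.
Qed.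

Let psd_laplacian : psd bip_laplacian.
Proof.
split=> [|x].
  by rewrite tr_block_mx !tr_diag_mx !linearN /= trmxK.
rewrite -(vsubmxK x); set y := usubmx x; set z := dsubmx x.
(* The quadratic form is the energy of the potential (y, z) on the weighted graph, with potential 0
   at the root. *)
suff -> : ((col_mx y z)^T *m bip_laplacian *m col_mx y z) 0 0 =
    \sum_i (c i * y i 0 ^+ 2 + \sum_j M i j * (y i 0 - z j 0) ^+ 2).
  apply: sumr_ge0 => i _; apply: addr_ge0; first by rewrite mulr_ge0 ?sqr_ge0.
  by apply: sumr_ge0 => j _; rewrite mulr_ge0 ?sqr_ge0.
rewrite tr_col_mx mul_row_block mul_row_col !mulmxDl !mul_mx_diag.
rewrite !mulmxN !mulNmx.
have -> : y^T *m M *m z = (z^T *m M^T *m y)^T by rewrite !trmx_mul !trmxK mulmxA.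
rewrite !mxE.
have -> : \sum_k (\matrix_(i, j) (y^T i j *
    (\row_l (c l + \sum_j' M l j')) 0 j)) 0 k * y k 0
  = \sum_i (c i * y i 0 ^+ 2 + \sum_j M i j * y i 0 ^+ 2).
  by apply: eq_bigr => i _; rewrite !mxE -mulr_suml; ring.
have -> : \sum_k (\matrix_(i, j) (z^T i j *
    (\row_l (\sum_j' M j' l)) 0 j)) 0 k * z k 0
  = \sum_i \sum_j M i j * z j 0 ^+ 2.
  by rewrite exchange_big; apply: eq_bigr => i _; rewrite !mxE -mulr_suml; ring.
have -> : \sum_j (z^T *m M^T) 0 j * y j 0 = \sum_i \sum_j M i j * (z j 0 * y i 0).
  apply: eq_bigr => i _; rewrite !mxE mulr_suml.
  by apply: eq_bigr => j _; rewrite !mxE; ring.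
rewrite addrAC !addrA -!sumrN -!big_split; apply: eq_bigr => i _ /=.
rewrite -!addrA; congr (_ + _); rewrite -!sumrN -!big_split.
by apply: eq_bigr => j _ /=; ring.
Qed.

Let psdS : psd S.
Proof. exact: psd_schur psd_laplacian. Qed.

(* [K = P^T diag(W, S) P] is the full Schur complement (root included, in
   position 0) plus [d d^T / W]. *)
Let P : 'M[R]_(1 + m) :=
  block_mx (d0 / W)%:M (W^-1 *: \row_j d j) (- const_mx 1) 1%:M.

Let K : 'M[R]_(1 + m) := P^T *m block_mx W%:M 0 0 S *m P.

Let det_P : \det P = 1.
Proof.
(* Adding all other columns to the first makes [P] upper triangular with unit diagonal, because d0
   and the d j add up to W. *)
have: \det (P *m block_mx 1%:M 0 (const_mx 1) 1%:M) = 1.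
  rewrite mulmx_block !(mulmx1, mulmx0, mul0mx, mul1mx, add0r) addNr.
  rewrite det_ublock det1 mulr1 det_mx11 !mxE /=.
  under eq_bigr => j _ do rewrite !mxE mulr1.
  by rewrite -mulr_sumr [_ * \sum__ _]mulrC -mulrDl divff // gt_eqF.
by rewrite det_mulmx det_lblock !det1 !mulr1.
Qed.

Let det_K : \det K = W * \det S.
Proof. by rewrite !det_mulmx det_tr det_P mul1r mulr1 det_ublock det_scalar1. Qed.

Let psdK : psd K.
Proof.
apply/psd_congr/psd_block => //; split=> [|x]; first exact: tr_scalar_mx.
rewrite mul_mx_scalar -scalemxAl !mxE big_ord1 mxE -expr2.
by rewrite mulr_ge0 ?sqr_ge0 // ltW.
Qed.

(** Rows of the full Schur complement sum to 0, so the entries of [S] add up to the diagonal entry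
    of the root. The computation uses only that row i of [M] sums to r i - c i. *)
Let S_sum : \sum_j \sum_k S j k = d0 - \sum_i c i ^+ 2 / r i.
Proof.
have -> : \sum_j \sum_k S j k =
    \sum_j d j - \sum_i (\sum_j M i j) * (\sum_k M i k) / r i.
  under eq_bigr => j _.
    under eq_bigr => k _ do rewrite SE.
    rewrite sumrB -mulr_suml (bigD1 j) //= eqxx big1 ?addr0 ?mul1r.
      over.
    by move=> k /negPf; rewrite eq_sym => ->.
  rewrite sumrB; congr (_ - _).
  under eq_bigr => j _ do rewrite exchange_big.
  rewrite exchange_big; apply: eq_bigr => i _ /=.
  rewrite mulr_suml mulr_suml; apply: eq_bigr => j _.
  by rewrite mulr_sumr mulr_suml.
have -> : \sum_i (\sum_j M i j) * (\sum_k M i k) / r i =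
    \sum_i r i - \sum_i c i - \sum_i c i + \sum_i c i ^+ 2 / r i.
  rewrite -!sumrB -big_split; apply: eq_bigr => i _ /=.
  have -> : \sum_j M i j = r i - c i by rewrite /r addrAC subrr add0r.
  by field; rewrite gt_eqF.
rewrite sum_r /W /d0; ring.
Qed.

(** The corner is d0 ^ 2 / W plus the sum of all entries of [S]. Here and in [Kjj] the weighted
    degree is factored out so that 1 + z <= exp z applies to the other factor. *)
Let K00 : K (lshift m 0) (lshift m 0) =
  d0 * (1 + (d0 / W - \sum_i c i ^+ 2 / d0 / r i)).
Proof.
rewrite /K /P tr_block_mx !mulmx_block block_mxEul.
rewrite !(mulmx0, mul0mx, addr0, add0r) tr_scalar_mx.
rewrite (_ : (- const_mx 1)^T = - const_mx 1); last first.
  by apply/matrixP=> i j; rewrite !mxE.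
rewrite mulmxN !mulNmx opprK -!scalar_mxM [LHS]mxE [X in X + _]mxE eqxx mulr1n.
rewrite mxE.
have -> : \sum_j ((const_mx 1 : 'rV_m) *m S) 0 j * (const_mx 1 : 'cV_m) j 0 =
    d0 - \sum_i c i ^+ 2 / r i.
  rewrite -S_sum [RHS]exchange_big; apply: eq_bigr => j _; rewrite !mxE mulr1.
  by apply: eq_bigr => k _; rewrite !mxE mul1r.
have -> : \sum_i c i ^+ 2 / d0 / r i = (\sum_i c i ^+ 2 / r i) / d0.
  by rewrite mulr_suml; apply: eq_bigr => i _; rewrite mulrAC.
by field; rewrite !gt_eqF.
Qed.

Let Kjj j : K (rshift 1 j) (rshift 1 j) =
  d j * (1 + (d j / W - \sum_i M i j ^+ 2 / d j / r i)).
Proof.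
rewrite /K /P tr_block_mx !mulmx_block block_mxEdr.
rewrite !(mulmx0, mul0mx, addr0, add0r) trmx1 mul1mx mulmx1.
rewrite mul_mx_scalar mxE SE eqxx mul1r !mxE big_ord1 !mxE.
have -> : \sum_i M i j ^+ 2 / d j / r i = (\sum_i M i j * M i j / r i) / d j.
  by rewrite mulr_suml; apply: eq_bigr => i _; rewrite mulrAC expr2.
by field; rewrite !gt_eqF.
Qed.

(** The determinant is prod r times [\det S], and Hadamard's inequality for [K] bounds W * [\det S]
    by a product of terms u * (1 + z) <= u * exp z. *)
Lemma det_bip_laplacian_le :
  \det bip_laplacian <=
  (\prod_i r i) * (\prod_j d j) * d0 / W *
  expR (1 - \sum_i (c i ^+ 2 / d0 + \sum_j M i j ^+ 2 / d j) / r i).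
Proof.
set s := \sum_i _ / _.
have le_expR (u z : R) : 0 < u -> u * (1 + z) <= u * expR z.
  by move=> u_gt0; rewrite ler_pM2l // expR_ge1Dx.
have WS : W * \det S <= d0 * (\prod_j d j) * expR (1 - s).
  rewrite -det_K; have /andP[_] := hadamard psdK; move/le_trans; apply.
  rewrite big_split_ord big_ord1 /= K00.
  apply: (@le_trans _ _ (d0 * expR (d0 / W - \sum_i c i ^+ 2 / d0 / r i) *
      \prod_j (d j * expR (d j / W - \sum_i M i j ^+ 2 / d j / r i)))).
    apply: ler_pM; rewrite ?le_expR //.
    - by rewrite -K00 psd_diag.
    - by apply: prodr_ge0 => j _; rewrite psd_diag.
    by apply: ler_prod => j _; rewrite psd_diag //= Kjj le_expR.
  rewrite big_split /= -expR_sum mulrACA -expRD.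
  rewrite le_eqVlt; apply/orP; left; apply/eqP; congr (_ * expR _).
  (* In the total exponent the terms d0 / W and d j / W add up to 1, and the remaining ones to -
     s. *)
  rewrite sumrB -mulr_suml addrACA -mulrDl divff ?gt_eqF // -opprD.
  congr (_ - _); rewrite exchange_big -big_split.
  by apply: eq_bigr => i _ /=; rewrite mulrDl mulr_suml.
rewrite det_schur // det_diag.
under [X in X * _]eq_bigr => i _ do rewrite mxE.
rewrite -!mulrA ler_pM2l; last first.
  by apply: prodr_gt0 => i _; exact: r_gt0.
move: WS; rewrite -ler_pdivlMl // => /le_trans; apply.
by rewrite le_eqVlt; apply/orP; left; apply/eqP; ring.
Qed.

End BipartiteLaplacian.

(** * Determinant expansion over functions oriented towards a root *)

(** Take for [h] the length of a shortest path to [v]: the next vertex on such a path is strictly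
    closer. *)
Lemma connect_rank (T : finType) (e : rel T) (v : T) :
  (forall x, connect e x v) ->
  exists h : T -> nat, forall x, x != v -> exists2 y, e x y & (h y < h x)%N.
Proof.
move=> conn.
pose reach x k := [exists p : k.-tuple T, path e x p && (last x p == v)].
have exP x : exists k, reach x k.
  have /connectP[p ep lp] := conn x; exists (size p).
  by apply/existsP; exists (in_tuple p); rewrite ep -lp eqxx.
exists (fun x => ex_minn (exP x)) => x x_neq_v.
case: (ex_minnP (exP x)) => k /existsP[[p /= /eqP <-] /andP[]].
case: p => [|y p] /=; first by rewrite (negPf x_neq_v).
move=> /andP[exy yp] lp _.
exists y => //; case: ex_minnP => l _; rewrite ltnS; apply.
by apply/existsP; exists (in_tuple p); rewrite yp.
Qed.

(** Multilinearity in the rows: [f] records which summand is taken in each row. *)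
Lemma det_sum_rows (R : comNzRingType) n (J : finType) (w : 'I_n -> J -> R)
    (C : 'I_n -> J -> 'I_n -> R) :
  \det (\matrix_(i, j) \sum_y w i y * C i y j) =
  \sum_(f : {ffun 'I_n -> J})
     (\prod_i w i (f i)) * \det (\matrix_(i, j) C i (f i) j).
Proof.
under [RHS]eq_bigr => f _ do rewrite /determinant mulr_sumr.
rewrite exchange_big; apply: eq_bigr => s _ /=.
under [in LHS]eq_bigr => i _ do rewrite mxE.
rewrite bigA_distr_bigA mulr_sumr; apply: eq_bigr => f _.
rewrite mulrCA -big_split; congr (_ * _).
by apply: eq_bigr => i _; rewrite mxE.
Qed.

Section RootedFunctions.
Variables (R : realFieldType) (T : finType) (v : T) (n : nat) (psi : 'I_n -> T).
Hypotheses (psi_inj : injective psi) (psi_root : forall i, psi i != v).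
Hypothesis psi_onto : forall x, x != v -> exists i, x = psi i.

(** Here [f i] is the parent of the non-root vertex [psi i]. A rank that decreases along parents
    excludes cycles, so iterating parents ends at the root. *)
Definition rooted (f : 'I_n -> T) :=
  exists h : T -> nat, forall i, (h (f i) < h (psi i))%N.

Let D (f : 'I_n -> T) : 'M[R]_n :=
  \matrix_(i, j) ((i == j)%:R - (f i == psi j)%:R).

(** Only the identity survives in the Leibniz formula. For another permutation s, take a moved index
    i of least rank: s i is moved too, so [f i] cannot be [psi (s i)], which would have smaller
    rank, and the factor at i is 0. *)
Lemma det_rooted f : rooted f -> \det (D f) = 1.
Proof.
case=> h hP; rewrite /determinant (bigD1 (1%g : {perm 'I_n})) //= odd_perm1 expr0 mul1r.
rewrite big1 => [|i _]; last first.
  rewrite perm1 mxE eqxx; case: eqP => [fi|_]; last by rewrite subr0.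
  by have := hP i; rewrite fi ltnn.
rewrite big1 ?addr0 // => s s1.
have [i0 si0] : exists i, s i != i.
  apply/existsP; apply: contraR s1; rewrite negb_exists => /forallP s1.
  by apply/eqP/permP => i; rewrite perm1; apply/eqP; have := s1 i; rewrite negbK.
case: (@arg_minnP _ i0 (fun i => s i != i) (h \o psi) si0) => i si min_i.
rewrite (bigD1 i) //= !mxE eq_sym (negPf si) sub0r.
case: eqP => [fi|_]; last by rewrite oppr0 mul0r mulr0.
have := hP i; rewrite fi ltnNge min_i //.
by rewrite (inj_eq perm_inj).
Qed.

(** The determinant is 1 if every vertex reaches the root along [f], and 0 otherwise. *)
Lemma det_functional_ge0 f : 0 <= \det (D f).
Proof.
pose g : rel T := fun x y => [exists i, (x == psi i) && (f i == y)].
have gE i y : g (psi i) y = (f i == y).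
  apply/existsP/idP => [[j /andP[/eqP/psi_inj -> //]]|fy].
  by exists i; rewrite eqxx.
have [/forallP conn|] := boolP [forall x, connect g x v].
  rewrite det_rooted ?ler01 //; have [h hP] := connect_rank conn.
  by exists h => i; have [y] := hP _ (psi_root i); rewrite gE => /eqP ->.
rewrite negb_forall => /existsP[x0 x0P].
have [i0 x0E] : exists i, x0 = psi i.
  by apply: psi_onto; apply: contraNneq x0P => ->.
pose Z x := ~~ connect g x v.
have Zf i : Z (f i) = Z (psi i).
  rewrite /Z; congr (~~ _); apply/idP/idP => [fv|/connectP[[|y p] /=]].
  - by apply: connect_trans fv; apply: connect1; rewrite gE.
  - by move=> _ pv; have := psi_root i; rewrite -pv eqxx.
  - by rewrite gE => /andP[/eqP -> yp] lp; apply/connectP; exists p.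
suff /eqP -> : \det (D f) == 0 by [].
(* The indicator of the vertices that never reach the root is in the kernel. *)
rewrite -det_tr; apply/det0P; exists (\row_j (Z (psi j))%:R).
  apply: contraNneq x0P => /rowP/(_ i0); rewrite !mxE -x0E => /eqP.
  by rewrite /Z /=; case: connect => //=; rewrite oner_eq0.
apply/rowP => i; rewrite !mxE.
under eq_bigr => j _ do rewrite !mxE mulrBr.
rewrite sumrB (bigD1 i) //= eqxx mulr1 big1 ?addr0 => [|j /negPf]; last first.
  by rewrite eq_sym => ->; rewrite mulr0.
rewrite -Zf; have [fv|/psi_onto[j fj]] := eqVneq (f i) v.
  rewrite fv {1}/Z connect0 big1 ?subr0 // => j _.
  by rewrite eq_sym (negPf (psi_root j)) mulr0.
rewrite fj (bigD1 j) //= eqxx mulr1 big1 ?addr0 ?subrr // => k /negPf kj.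
by rewrite (inj_eq psi_inj) eq_sym kj mulr0.
Qed.

(** One half of a weighted matrix-tree theorem: in the expansion by rows all terms are nonnegative,
    those in [F] have determinant 1, and the others are dropped. *)
Lemma sum_rooted_le_det (w : 'I_n -> T -> R) (F : {set {ffun 'I_n -> T}}) :
  (forall i y, 0 <= w i y) -> (forall f, f \in F -> rooted f) ->
  \sum_(f in F) \prod_i w i (f i) <=
  \det (\matrix_(i, j) \sum_y w i y * ((i == j)%:R - (y == psi j)%:R)).
Proof.
move=> w_ge0 rootF; rewrite det_sum_rows [leRHS](bigID [in F]) /=.
rewrite ler_wpDr //.
  by apply: sumr_ge0 => f _; rewrite mulr_ge0 ?prodr_ge0 ?det_functional_ge0.
apply: ler_sum => f /rootF/det_rooted fdet.
by rewrite [X in _ * X]fdet mulr1.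
Qed.


End RootedFunctions.

(** * Spanning trees encoded by parent functions *)

Section SpanningTrees.
Variables (T : finType) (e : rel T).
Hypotheses (e_sym : symmetric e) (e_irr : irreflexive e).

Lemma mem_edges x y : ([set x; y] \in edges e) = e x y.
Proof.
apply/imset2P/idP => [[x' y' _]|exy]; last by exists x y => //; rewrite inE.
rewrite inE /= => e' xy.
have [/set2P[] xE /set2P[] yE] : x \in [set x'; y'] /\ y \in [set x'; y'].
  by rewrite -xy set21 set22.
- have : y' \in [set x; y] by rewrite xy set22.
  by rewrite xE yE => /set2P[] y'E; rewrite y'E e_irr in e'.
- by rewrite xE yE.
- by rewrite xE yE e_sym.
- have : x' \in [set x; y] by rewrite xy set21.
  by rewrite xE yE => /set2P[] x'E; rewrite x'E e_irr in e'.
Qed.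

Variables (v : T) (n : nat) (psi : 'I_n -> T).
Hypotheses (psi_inj : injective psi) (psi_root : forall i, psi i != v).
Hypothesis psi_onto : forall x, x != v -> exists i, x = psi i.

Definition parent_edges (f : 'I_n -> T) : {set {set T}} :=
  [set [set psi i; f i] | i in 'I_n].

(** The parent of a vertex is a neighbour in [t] closer to [v]. Parent edges already connect every
    vertex to [v], so acyclicity leaves room for no other edge. *)
Lemma spanning_tree_parent t : spanning_tree e t ->
  exists f : {ffun 'I_n -> T}, rooted psi f /\ t = parent_edges f.
Proof.
case=> te tconn tacyc.
have [h hP] := connect_rank (fun x => tconn x v).
have /fin_all_exists2[f tf hf] i : exists2 y, adj t (psi i) y & (h y < h (psi i))%N.
  exact/hP/psi_root.
exists (finfun f); split; first by exists h => i; rewrite ffunE.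
set t' := parent_edges _.
have adj_sym (s : {set {set T}}) : symmetric (adj s).
  by move=> x y; rewrite /adj /= setUC.
have t't : t' \subset t.
  by apply/subsetP => _ /imsetP[i _ ->]; rewrite ffunE; exact: tf.
have conn_v x : connect (adj t') x v.
  have [k] := ubnP (h x); elim: k x => // k IHk x; rewrite ltnS => hx.
  have [->|/psi_onto[i xE]] := eqVneq x v; first exact: connect0.
  apply: (@connect_trans _ _ (f i)).
    by apply: connect1; apply/imsetP; exists i; rewrite ?ffunE ?xE.
  by apply: IHk; apply: leq_trans hx; rewrite xE hf.
apply/eqP; rewrite eqEsubset t't andbT; apply/subsetP => E tE.
have /imset2P[x y _] := subsetP te _ tE; rewrite inE /= => exy EE.
apply: contraT => nt'; rewrite EE in nt'.
(* An edge of [t] outside [t'] would close a cycle with a path of [t']. *)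
have : connect (adj t') x y.
  apply: connect_trans (conn_v x) _.
  by rewrite (sym_connect_sym (adj_sym t')).
case/connectP => p0 p0path; case/shortenP: p0path => p pp pu _ yE.
have : ucycle (adj t) (x :: p).
  rewrite /ucycle pu andbT /= rcons_path -yE.
  rewrite (sub_path _ pp) /=; first by rewrite adj_sym /adj /= -EE.
  by move=> a b; apply: (subsetP t't).
(* Acyclicity still allows size at most 2: an empty [p] would make the edge a loop, and a one-vertex
   [p] would put it in [t']. *)
move/tacyc; case: p pp pu yE => [|z [|//]] /=.
  by move=> _ _ yE; rewrite yE e_irr in exy.
by move=> /andP[xz _] _ yE; case/negP: nt'; rewrite yE.
Qed.

(** The edges at [v] are the parent edges of the i with [f i = v], and each determines i because
    [psi i] is its end other than [v]. *)
Lemma prod_parent_weight (R : comNzRingType) (x : R) (f : 'I_n -> T) :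
  rooted psi f ->
  \prod_i (if f i == v then x else 1) = x ^+ tree_degree (parent_edges f) v.
Proof.
case=> h hf; rewrite -big_mkcond prodr_const; congr (_ ^+ _).
rewrite /tree_degree -(@card_in_imset _ _ (fun i => [set psi i; f i])); last first.
  move=> i j; rewrite !unfold_in => /eqP -> /eqP -> /setP/(_ (psi i)).
  rewrite !inE eqxx (negPf (psi_root i)) !orbF => /esym/eqP; exact: psi_inj.
congr #|pred_of_set _|; apply/setP => E; rewrite inE; apply/imsetP/andP => [[i]|[]].
  rewrite unfold_in => fv ->; split; first exact: imset_f.
  by rewrite (eqP fv) set22.
case/imsetP => i _ -> vi; exists i => //; rewrite unfold_in.
by move: vi; rewrite !inE eq_sym (negPf (psi_root i)) eq_sym.
Qed.

(** Choosing one parent function per tree is injective, since the tree is recovered as its set of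
    parent edges; the image is then a family of rooted functions of the same weights. *)
Lemma sum_tree_weight_le_det (R : realFieldType) (x : R) (F : {set {set {set T}}}) :
  0 < x -> {in F, forall t, spanning_tree e t} ->
  \sum_(t in F) x ^+ tree_degree t v <=
  \det (\matrix_(i, j) \sum_y
     (e (psi i) y)%:R * (if y == v then x else 1) *
     ((i == j)%:R - (y == psi j)%:R)).
Proof.
move=> x_gt0 treeF.
have /fin_all_exists[pf pfP] t : exists f : {ffun 'I_n -> T},
    t \in F -> rooted psi f /\ t = parent_edges f.
  have [/treeF/spanning_tree_parent[f fP]|] := boolP (t \in F); first by exists f.
  by exists [ffun=> v].
have pf_inj : {in F &, injective pf}.
  by move=> s t /pfP[_ sE] /pfP[_ tE] st; rewrite sE tE st.
pose w i y : R := (e (psi i) y)%:R * (if y == v then x else 1).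
apply: le_trans (@sum_rooted_le_det R T v n psi psi_inj psi_root psi_onto
  w (pf @: F) _ _); last first.
- by move=> _ /imsetP[t /pfP[? _] ->].
- by move=> i y; rewrite /w; case: ifP => _; rewrite mulr_ge0 // ltW.
rewrite big_imset //=; apply: ler_sum => t tF.
have [rt tE] := pfP _ tF; rewrite {1}tE -prod_parent_weight // le_eqVlt.
apply/orP; left; apply/eqP/eq_bigr => i _; rewrite /w.
have -> : e (psi i) (pf t i); last by rewrite mul1r.
rewrite -mem_edges; have [/subsetP te _ _] := treeF _ tF.
by apply: te; rewrite {2}tE; apply: imset_f.
Qed.

End SpanningTrees.

(** * Specialisation to biregular graphs *)

(** Here [m] counts the second part without the root, whence the exponent [m.+1]. The weighted
    degrees are a or a - 1 + x in the first part, x b at the root and b elsewhere, so W = b (m +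
    x). *)
Lemma det_biregular_laplacian_le (R : realType) n m (a b : nat) (x : R)
    (E : 'I_n -> 'I_m -> bool) (E0 : 'I_n -> bool) :
  0 < x -> (0 < n)%N -> (0 < a)%N -> (0 < b)%N ->
  (forall i, (E0 i)%:R + \sum_j (E i j)%:R = a%:R :> R) ->
  (forall j, \sum_i (E i j)%:R = b%:R :> R) -> \sum_i (E0 i)%:R = b%:R :> R ->
  \det (bip_laplacian (\matrix_(i, j) (E i j)%:R) (fun i => x * (E0 i)%:R)) <=
  x * expR ((x - 1) * (b%:R / a%:R)) *
  (a%:R ^+ n * b%:R ^+ m.+1 / ((m%:R + x) * n%:R)).
Proof.
move=> x_gt0 n_gt0 a_gt0 b_gt0 degA degB degv.
have a0 : 0 < a%:R :> R by rewrite ltr0n.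
have b0 : 0 < b%:R :> R by rewrite ltr0n.
have n0 : 0 < n%:R :> R by rewrite ltr0n.
have mx0 : 0 < m%:R + x by rewrite ltr_wpDl.
pose r i := a%:R + (x - 1) * (E0 i)%:R : R.
have rE i : x * (E0 i)%:R + \sum_j (\matrix_(i, j) (E i j)%:R : 'M[R]_(n, m)) i j = r i.
  by under eq_bigr => j _ do rewrite mxE; rewrite /r -(degA i); ring.
have dE j : \sum_i (\matrix_(i, j) (E i j)%:R : 'M[R]_(n, m)) i j = b%:R.
  by under eq_bigr => i _ do rewrite mxE; exact: degB.
have d0E : \sum_i x * (E0 i)%:R = x * b%:R by rewrite -mulr_sumr degv.
have r_gt0 i : 0 < r i.
  rewrite /r; case: (E0 i); last by rewrite mulr0 addr0.
  rewrite mulr1 addrCA -[ltLHS]addr0 ltr_leD // subr_ge0.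
  by rewrite ler1n.
have le_det := @det_bip_laplacian_le R n m (\matrix_(i, j) (E i j)%:R)
  (fun i => x * (E0 i)%:R).
apply: le_trans (le_det _ _ _ _ _) _ => {le_det} [i j|i|i|j||].
- by rewrite mxE.
- by rewrite mulr_ge0 // ltW.
- by rewrite rE.
- by rewrite dE.
- by rewrite d0E mulr_gt0.
rewrite d0E (eq_bigr _ (fun i _ => rE i)) !(eq_bigr _ (fun j _ => dE j)).
(* For each i the numerator is (x E0 i + a - E0 i) / b = r i / b, so every term of the sum is 1 / b,
   independently of x. *)
have -> : \sum_i ((x * (E0 i)%:R) ^+ 2 / (x * b%:R) +
    \sum_j (\matrix_(i, j) (E i j)%:R : 'M[R]_(n, m)) i j ^+ 2 /
      \sum_i (\matrix_(i, j) (E i j)%:R : 'M[R]_(n, m)) i j) /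
    (x * (E0 i)%:R + \sum_j (\matrix_(i, j) (E i j)%:R : 'M[R]_(n, m)) i j) =
    n%:R / b%:R.
  rewrite (eq_bigr (fun=> b%:R^-1)) => [|i _].
    by rewrite sumr_const card_ord [RHS]mulr_natl.
  under eq_bigr => j _ do rewrite dE mxE expr2 -natrM mulnb andbb.
  rewrite rE -mulr_suml.
  have -> : \sum_j (E i j)%:R = a%:R - (E0 i)%:R :> R by rewrite -(degA i); ring.
  have := r_gt0 i; rewrite /r; case: (E0 i) => /= ri; field.
    by rewrite !gt_eqF //; lra.
  by rewrite !gt_eqF.
(* Write r i = a (1 + (x - 1) E0 i / a) and use 1 + z <= exp z; exactly b of the [E0 i] are 1. *)
have prod_r : \prod_i r i <= a%:R ^+ n * expR ((x - 1) * (b%:R / a%:R)).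
  have -> : (x - 1) * (b%:R / a%:R) = \sum_i (x - 1) * (E0 i)%:R / a%:R :> R.
    by rewrite -mulr_suml -mulr_sumr degv mulrA.
  rewrite expR_sum -[X in _ ^+ X]card_ord -prodr_const -big_split /=.
  apply: ler_prod => i _; rewrite ltW //=.
  apply: le_trans (_ : a%:R * (1 + (x - 1) * (E0 i)%:R / a%:R) <= _).
    by rewrite mulrDr mulr1 mulrCA divff ?mulr1 // gt_eqF.
  by rewrite ler_pM2l // expR_ge1Dx.
(* This is s = 1 + (s - 1) <= exp (s - 1), inverted, with s = n / b. *)
have exp_s : expR (1 - n%:R / b%:R) <= b%:R / n%:R :> R.
  rewrite -opprB expRN -[leRHS]invf_div lef_pV2 ?posrE ?expR_gt0 ?divr_gt0 //.
  by rewrite -[leLHS](subrK 1) addrC expR_ge1Dx.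
rewrite prodr_const sumr_const card_ord.
set u := expR ((x - 1) * _) in prod_r *.
apply: (@le_trans _ _ (a%:R ^+ n * u * b%:R ^+ m * (x * b%:R) /
    (x * b%:R + b%:R *+ m) * (b%:R / n%:R))).
  have W0 : 0 < x * b%:R + b%:R *+ m.
    by rewrite ltr_wpDr ?mulr_gt0 // mulrn_wge0 // ltW.
  apply: ler_pM => //; rewrite ?expR_ge0 //.
    by rewrite !mulr_ge0 ?invr_ge0 ?prodr_ge0 ?exprn_ge0 // => *; apply: ltW.
  by rewrite !ler_pM2r ?invr_gt0 ?mulr_gt0 ?exprn_gt0.
rewrite le_eqVlt; apply/orP; left; apply/eqP; rewrite -mulr_natr exprS.
by field; rewrite !gt_eqF // [ltRHS]addrC [x * _]mulrC -mulrDr mulr_gt0.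
Qed.

Lemma degree_sum (R : pzSemiRingType) (T : finType) (e : rel T) x :
  (degree e x)%:R = \sum_y (e x y)%:R :> R.
Proof.
rewrite /degree -sum1_card natr_sum big_mkcond /=.
by apply: eq_bigr => y _; rewrite inE; case: (e x y).
Qed.

Section Biregular.
Variables (R : realType) (T : finType) (e : rel T) (A B : {set T}).
Variables (a b : nat) (v : T).
Hypotheses (e_sym : symmetric e) (e_irr : irreflexive e).
Hypotheses (e_bip : bipartition e A B) (e_bireg : biregular e A B a b).
Hypotheses (v_B : v \in B) (b_gt0 : (0 < b)%N).

Let n := #|A|.
Let m := #|B :\ v|.
Let alpha (i : 'I_n) : T := enum_val i.
Let beta (j : 'I_m) : T := enum_val j.

(** Lists [A] first and then [B] without [v], so that the Laplacian in this order has the blocks of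
    [bip_laplacian]. *)
Let psi (i : 'I_(n + m)) : T :=
  match split i with inl i => alpha i | inr j => beta j end.

Let notinA x : (x \notin A) = (x \in B).
Proof.
case: e_bip => AB dAB _; have : x \in A :|: B by rewrite AB inE.
rewrite inE; have [xA _|xA /= -> //] := boolP (x \in A).
by rewrite (disjointFr dAB xA).
Qed.

Let alphaA i : alpha i \in A. Proof. exact: enum_valP. Qed.

Let betaB j : beta j \in B.
Proof. by have := enum_valP j; rewrite inE => /andP[]. Qed.

Let beta_v j : beta j != v.
Proof. by have := enum_valP j; rewrite !inE => /andP[]. Qed.

Let alpha_notB i : (alpha i \in B) = false.
Proof. by rewrite -notinA alphaA. Qed.

Let alpha_v i : alpha i != v.
Proof. by apply: contraFneq (alpha_notB i) => ->. Qed.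

Let alpha_beta i j : alpha i == beta j = false.
Proof. by apply: contraFF (alpha_notB i) => /eqP ->. Qed.

Let e_AA x y : x \in A -> y \in A -> e x y = false.
Proof.
move=> xA yA; apply/negP => exy; have [_ _ /(_ _ _ exy)] := e_bip.
by rewrite xA -notinA yA.
Qed.

Let e_BB x y : x \in B -> y \in B -> e x y = false.
Proof.
move=> xB yB; apply/negP => exy; have [_ _ /(_ _ _ exy)] := e_bip.
by rewrite yB; apply/negP; rewrite notinA.
Qed.

Let psil i : psi (lshift m i) = alpha i.
Proof. by rewrite /psi -[lshift m i]/(unsplit (inl i)) unsplitK. Qed.

Let psir j : psi (rshift n j) = beta j.
Proof. by rewrite /psi -[rshift n j]/(unsplit (inr j)) unsplitK. Qed.

Let psi_inj : injective psi.
Proof.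
move=> i j; rewrite -(splitK i) -(splitK j).
case: (split i) (split j) => [i'|i'] [j'|j'] /=; rewrite !(psil, psir).
- by move/enum_val_inj ->.
- by move/eqP; rewrite alpha_beta.
- by move/eqP; rewrite eq_sym alpha_beta.
- by move/enum_val_inj ->.
Qed.

Let psi_root i : psi i != v.
Proof. by rewrite -(splitK i); case: split => j /=; rewrite ?psil ?psir. Qed.

Let psi_onto x : x != v -> exists i, x = psi i.
Proof.
move=> xv; have [xA|] := boolP (x \in A).
  by exists (lshift m (enum_rank_in xA x)); rewrite psil /alpha enum_rankK_in.
rewrite notinA => xB; have xB' : x \in B :\ v by rewrite !inE xv.
by exists (rshift n (enum_rank_in xB' x)); rewrite psir /beta enum_rankK_in.
Qed.

Let big_vertices (F : T -> R) :
  \sum_y F y = \sum_i F (alpha i) + (F v + \sum_j F (beta j)).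
Proof.
rewrite (bigID [in A]) /= big_enum_val; congr (_ + _).
rewrite (eq_bigl [in B]) => [|y]; last by rewrite notinA.
by rewrite (big_setD1 v) //= [X in _ + X = _]big_enum_val.
Qed.

Let sum_A (F : T -> R) i : \sum_y (e (alpha i) y)%:R * F y =
  (e (alpha i) v)%:R * F v + \sum_j (e (alpha i) (beta j))%:R * F (beta j).
Proof.
rewrite big_vertices big1 ?add0r // => k _.
by rewrite e_AA // mul0r.
Qed.

Let sum_B (F : T -> R) y : y \in B ->
  \sum_z (e y z)%:R * F z = \sum_i (e (alpha i) y)%:R * F (alpha i).
Proof.
move=> yB; rewrite big_vertices e_BB // mul0r add0r [X in _ + X]big1 ?addr0 //.
  by apply: eq_bigr => i _; rewrite e_sym.
by move=> j _; rewrite e_BB // mul0r.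
Qed.

Let n_gt0 : (0 < n)%N.
Proof.
have := b_gt0; rewrite -(e_bireg.2 _ v_B) => /card_gt0P[y]; rewrite inE => evy.
apply/card_gt0P; exists y; apply: contraLR evy; rewrite notinA => yB.
by rewrite e_BB.
Qed.

Let a_gt0 : (0 < a)%N.
Proof.
have := b_gt0; rewrite -(e_bireg.2 _ v_B) => /card_gt0P[y]; rewrite inE => evy.
have yA : y \in A.
  by apply: contraLR evy; rewrite notinA => yB; rewrite e_BB.
by rewrite -(e_bireg.1 _ yA); apply/card_gt0P; exists v; rewrite inE e_sym.
Qed.

Lemma sum_tree_weight_le (x : R) (F : {set {set {set T}}}) :
  0 < x -> {in F, forall t, spanning_tree e t} ->
  \sum_(t in F) x ^+ tree_degree t v <=
  x * expR ((x - 1) * (b%:R / a%:R)) *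
  (a%:R ^+ #|A| * b%:R ^+ #|B| / ((#|B|%:R - 1 + x) * #|A|%:R)).
Proof.
move=> x_gt0 treeF.
apply: le_trans (sum_tree_weight_le_det e_sym e_irr psi_inj psi_root psi_onto
  x_gt0 treeF) _.
have cardB : #|B| = m.+1 by rewrite (cardsD1 v) v_B.
rewrite cardB -natr1 addrK.
apply: le_trans _ (@det_biregular_laplacian_le R n m a b x
  (fun i j => e (alpha i) (beta j)) (fun i => e (alpha i) v)
  x_gt0 n_gt0 a_gt0 b_gt0 _ _ _); first last.
- have := degree_sum R e v; rewrite (e_bireg.2 _ v_B) => ->.
  under [RHS]eq_bigr => y _ do rewrite -[_%:R]mulr1.
  by rewrite sum_B //; apply: eq_bigr => i _; rewrite mulr1.
- move=> j; have := degree_sum R e (beta j); rewrite (e_bireg.2 _ (betaB j)) => ->.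
  under [RHS]eq_bigr => y _ do rewrite -[_%:R]mulr1.
  by rewrite sum_B //; apply: eq_bigr => i _; rewrite mulr1.
- move=> i; have := degree_sum R e (alpha i); rewrite (e_bireg.1 _ (alphaA i)) => ->.
  under [RHS]eq_bigr => y _ do rewrite -[_%:R]mulr1.
  by rewrite sum_A mulr1; under [in RHS]eq_bigr => j _ do rewrite mulr1.
rewrite le_eqVlt; apply/orP; left; apply/eqP; congr (\det _); apply/matrixP => i j.
rewrite mxE.
(* This separates the weighted degree on the diagonal from the adjacency entry, whose weight is 1
   because [psi j] is not the root. *)
have -> : \sum_y (e (psi i) y)%:R * (if y == v then x else 1) *
      ((i == j)%:R - (y == psi j)%:R) =
    (i == j)%:R * (\sum_y (e (psi i) y)%:R * (if y == v then x else 1)) -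
    (e (psi i) (psi j))%:R.
  under eq_bigr => y _ do rewrite mulrBr.
  rewrite sumrB -mulr_suml mulrC; congr (_ - _).
  rewrite (bigD1 (psi j)) //= eqxx (negPf (psi_root j)) !mulr1 big1 ?addr0 //.
  by move=> y /negPf ->; rewrite mulr0.
rewrite -(splitK i) -(splitK j).
case: (split i) (split j) => [i'|i'] [j'|j'] /=; rewrite !(psil, psir).
- rewrite block_mxEul !mxE e_AA // subr0 eq_lshift mulr_natl; congr (_ *+ _).
  rewrite sum_A eqxx mulrC; congr (_ + _); apply: eq_bigr => k _.
  by rewrite mxE (negPf (beta_v k)) mulr1.
- by rewrite block_mxEur !mxE eq_lrshift mul0r sub0r.
- by rewrite block_mxEdl !mxE eq_rlshift mul0r sub0r e_sym.
- rewrite block_mxEdr !mxE e_BB // subr0 eq_rshift mulr_natl; congr (_ *+ _).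
  rewrite sum_B //; apply: eq_bigr => k _.
  by rewrite mxE (negPf (alpha_v k)) mulr1.
Qed.

End Biregular.

(** * Tail bounds for the degree of [v] *)

Theorem theorem3 (R : realType) (T : finType) (e : rel T) (A B : {set T})
    (n m a b : nat) (v : T) (k : nat) (theta : R)
    (e_sym : symmetric e) (e_irr : irreflexive e)
    (e_conn : connected_graph e)
    (e_bip : bipartition e A B)
    (card_A : #|A| = n) (card_B : #|B| = m)
    (e_bireg : biregular e A B a b)
    (b_def : b%:R = a%:R * n%:R / m%:R :> R)
    (v_B : v \in B)
    (k_def : k%:R = theta * (b%:R / a%:R))
    (k_lt_b : (k < b)%N) :
  (1 <= theta ->
     (tau_gt e v k)%:R <=
       (theta^-1 * expR ((theta - 1) / theta)) ^+ k
       * (a%:R ^+ n * b%:R ^+ m / (m%:R * n%:R)))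
  /\
  (theta <= 1 -> (1 < m)%N ->
     (tau_le e v k.+1)%:R <=
       (theta^-1 * expR ((theta - 1) / theta)) ^+ k
       * (a%:R ^+ n * b%:R ^+ m / ((m%:R - 1) * n%:R))).
Proof.
have b_gt0 : (0 < b)%N by apply: leq_ltn_trans k_lt_b.
have n_gt0 : (0 < n)%N.
  rewrite lt0n; apply: contraTneq b_gt0 => n0.
  by rewrite -(ltr0n R) b_def n0 mulr0 mul0r ltxx.
have m_gt0 : (0 < m)%N by rewrite -card_B; apply/card_gt0P; exists v.
have bound := @sum_tree_weight_le R _ _ _ _ _ _ _ e_sym e_irr e_bip e_bireg v_B b_gt0.
rewrite card_A card_B in bound.
have m1_ge0 : 0 <= m%:R - 1 :> R by rewrite subr_ge0 ler1n.
(* The exponent k + 1 fits both claims: degree > k means degree >= k + 1, used with x >= 1, and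
   degree <= k + 1 is used with x <= 1. One factor x cancels against the leading x of [bound]. *)
have count (x : R) (F : {set {set {set T}}}) :
    0 < x -> {in F, forall t, spanning_tree e t} ->
    {in F, forall t, x ^+ k.+1 <= x ^+ tree_degree t v} ->
    x ^+ k * #|F|%:R <= expR ((x - 1) * (b%:R / a%:R)) *
      (a%:R ^+ n * b%:R ^+ m / ((m%:R - 1 + x) * n%:R)).
  move=> x0 treeF degF; rewrite -(ler_pM2l x0) [leLHS]mulrA -exprS.
  rewrite [leRHS]mulrA; apply: le_trans (bound _ _ x0 treeF).
  by rewrite mulr_natr -sumr_const; apply: ler_sum => t /degF.
(* The constant c replaces m - 1 + theta by a lower bound: m when theta >= 1, and m - 1 when theta
   <= 1. *)
have solve (F : {set {set {set T}}}) (c : R) : 0 < theta -> 0 < c ->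
    c <= m%:R - 1 + theta ->
    {in F, forall t, spanning_tree e t} ->
    {in F, forall t, theta ^+ k.+1 <= theta ^+ tree_degree t v} ->
    #|F|%:R <= (theta^-1 * expR ((theta - 1) / theta)) ^+ k *
       (a%:R ^+ n * b%:R ^+ m / (c * n%:R)).
  move=> th0 c0 c_le treeF degF.
  (* Since k = theta * b / a, the exponent k (theta - 1) / theta is (theta - 1) b / a. *)
  have -> : (theta^-1 * expR ((theta - 1) / theta)) ^+ k =
      (theta ^+ k)^-1 * expR ((theta - 1) * (b%:R / a%:R)).
    rewrite exprMn exprVn -expRM_natl k_def; congr (_ * expR _).
    by move: (b%:R / a%:R) => q; field; rewrite gt_eqF.
  rewrite -mulrA ler_pdivlMl ?exprn_gt0 //.
  apply: le_trans (count _ _ th0 treeF degF) _.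
  rewrite ler_pM2l ?expR_gt0 // ler_wpM2l ?mulr_ge0 ?exprn_ge0 //.
  by rewrite lef_pV2 ?posrE ?mulr_gt0 ?ltr0n ?ler_pM2r ?ltr0n // (lt_le_trans c0).
split=> [th1|th1 m_gt1].
  apply: solve; rewrite ?ltr0n //.
  - exact: lt_le_trans th1.
  - by rewrite -lerBlDl opprB addrC subrK.
  - by move=> t; rewrite inE => /andP[/asboolP].
  - by move=> t; rewrite inE => /andP[_ kt]; rewrite ler_weXn2l.
have m1_gt0 : 0 < m%:R - 1 :> R by rewrite subr_gt0 ltr1n.
(* If [k = 0] then [theta = 0] is not a positive weight; use weight 1. *)
have [k0|k_gt0] := posnP k.
  rewrite -[leLHS]mul1r -[X in X * _ <= _](expr1n R k).
  apply: le_trans (count 1 _ ltr01 _ _) _.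
  - by move=> t; rewrite inE => /andP[/asboolP].
  - by move=> t _; rewrite !expr1n.
  rewrite subrr mul0r expR0 k0 expr0 !mul1r ler_wpM2l ?mulr_ge0 ?exprn_ge0 //.
  by rewrite subrK lef_pV2 ?posrE ?mulr_gt0 ?ltr0n // ler_pM2r ?ltr0n // gerBl.
have th0 : 0 < theta.
  have := k_gt0; rewrite -(ltr0n R) k_def pmulr_lgt0 //.
  rewrite lt_neqAle eq_sym divr_ge0 // andbT.
  by apply: contraTneq k_gt0 => ba0; rewrite -(ltr0n R) k_def ba0 mulr0 ltxx.
apply: solve => //.
- by rewrite lerDl ltW.
- by move=> t; rewrite inE => /andP[/asboolP].
- by move=> t; rewrite inE => /andP[_ kt]; rewrite ler_wiXn2l ?(ltW th0).
Qed.
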